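(* For a prime power $q\ge 2$, let $M(q)=1/S(h(q))$, where $$h(q)=\left(\frac{q^{1/2}+1}{q^{1/2}-1}\right)^2$$ and $S$ is Specht's ratio. Let $A$ be an abelian variety of dimension $g$ and trace $-\tau$ over the finite field $\mathbb{F}_q$. (i) We have $$|A(\mathbb{F}_q)| \geq M(q)^g\Bigl(q+1+\frac{\tau}{g}\Bigr)^g.$$ (ii) In particular, $$|A(\mathbb{F}_q)| \geq \Bigl(1-\frac{2}{q}\Bigr)^g\Bigl(q+1+\frac{\tau}{g}\Bigr)^g,$$ where $1-2/q$ has to be replaced by $0.261$ if $q=2$.
   Context: Specht's ratio is defined by $S(h)=\dfrac{h^{1/(h-1)}}{e\,\log\bigl(h^{1/(h-1)}\bigr)}$ for real $h>1$, and $S(1)=1$. The Weil polynomial $f_A(t)$ of an abelian variety $A$ of dimension $g$ over $\mathbb{F}_q$ is the characteristic polynomial of its Frobenius endomorphism. Its complex roots are written $\omega_1,\dots,\omega_g,\overline{\omega}_1,\dots,\overline{\omega}_g$, with $|\omega_i|=q^{1/2}$. Put $x_i=-(\omega_i+\overline{\omega}_i)$ for $1\le i\le g$ and $\tau=\sum_{i=1}^g x_i\in\mathbb{Z}$; one says that $A$ has trace $-\tau$. The number of rational points is $|A(\mathbb{F}_q)|=f_A(1)=\prod_{i=1}^g(q+1+x_i)$. *)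

(* Defs.v *)
From HB Require Import structures.
From mathcomp Require Import all_boot all_order all_algebra all_field.
From mathcomp Require mpoly.

Set Implicit Arguments.
Unset Strict Implicit.
Unset Printing Implicit Defensive.

Import Order.TTheory GRing.Theory Num.Theory.
Local Open Scope ring_scope.

(** * Abelian varieties over a perfect field [F], in classical language

    [iota : F -> K] is an embedding of [F] in an algebraic closure [K].
    A variety is described by its set of [K]-points, together with equations
    and morphisms that have coefficients in [F].  *)

(* [mpoly] is imported in a module only because its notations clash with those
   of MathComp-Analysis, which is needed further down. *)
Module AbVar.
Import mpoly.

(* A point of P^n(L) is represented by its unique homogeneous coordinate vector
   whose first nonzero entry is 1. *)
Definition normalized (L : fieldType) (n : nat) (v : 'rV[L]_n.+1) : bool :=
  [exists i, (v 0 i == 1) && [forall j : 'I_n.+1, (j < i)%N ==> (v 0 j == 0)]].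

Definition on_eqs (F L : fieldType) (j : F -> L) (n : nat)
    (eqs : seq {mpoly F[n.+1]}) (v : 'rV[L]_n.+1) : bool :=
  normalized v && all (fun p => mmap j (v 0) p == 0) eqs.

Definition points (F L : fieldType) (j : F -> L) (n : nat)
    (eqs : seq {mpoly F[n.+1]}) : Type := {v : 'rV[L]_n.+1 | on_eqs j eqs v}.

(* Zariski topology on the [L]-points: the closed sets are cut out by
   homogeneous polynomials with coefficients in [L]. *)
Definition zclosed (F L : fieldType) (j : F -> L) (n : nat)
    (eqs : seq {mpoly F[n.+1]}) (Z : points j eqs -> Prop) : Prop :=
  exists s : seq {mpoly L[n.+1]},
    (forall p, p \in s -> exists d : nat, p \is d.-homog) /\
    (forall x, Z x <-> all (fun p => p.@[val x 0] == 0) s).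

Definition zirreducible (F L : fieldType) (j : F -> L) (n : nat)
    (eqs : seq {mpoly F[n.+1]}) (Z : points j eqs -> Prop) : Prop :=
  (exists x, Z x) /\
  (forall Z1 Z2 : points j eqs -> Prop, zclosed Z1 -> zclosed Z2 ->
     (forall x, Z x -> Z1 x \/ Z2 x) ->
     (forall x, Z x -> Z1 x) \/ (forall x, Z x -> Z2 x)).

Definition zchain (F L : fieldType) (j : F -> L) (n : nat)
    (eqs : seq {mpoly F[n.+1]}) (d : nat)
    (Z : nat -> points j eqs -> Prop) : Prop :=
  (forall i, (i <= d)%N -> zclosed (Z i) /\ zirreducible (Z i)) /\
  (forall i, (i < d)%N ->
     (forall x, Z i x -> Z i.+1 x) /\ exists x, Z i.+1 x /\ ~ Z i x).

Definition krull_dim (F L : fieldType) (j : F -> L) (n : nat)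
    (eqs : seq {mpoly F[n.+1]}) (g : nat) : Prop :=
  (exists Z : nat -> points j eqs -> Prop, zchain g Z) /\
  (forall (d : nat) (Z : nat -> points j eqs -> Prop), zchain d Z -> (d <= g)%N).

Definition bihomog (F : fieldType) (n : nat) (d e : nat)
    (p : {mpoly F[n.+1 + n.+1]}) : Prop :=
  forall m, m \in msupp p ->
    (\sum_(i < n.+1) m (lshift n.+1 i) = d)%N /\
    (\sum_(i < n.+1) m (rshift n.+1 i) = e)%N.

(* A map X -> X is a morphism over [F] if, near each point, it is given by
   forms of equal degree over [F] without common zero at that point. *)
Definition regular1 (F L : fieldType) (j : F -> L) (n : nat)
    (eqs : seq {mpoly F[n.+1]}) (f : points j eqs -> points j eqs) : Prop :=
  forall x, exists (d : nat) (P : 'I_n.+1 -> {mpoly F[n.+1]}),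
    let ev (y : points j eqs) := \row_i mmap j (val y 0) (P i) in
    [/\ forall i, P i \is d.-homog,
        ev x != 0 &
        forall y, ev y != 0 -> exists c : L, ev y = c *: val (f y)].

(* Morphisms X * X -> X, likewise, by bihomogeneous polynomials. *)
Definition regular2 (F L : fieldType) (j : F -> L) (n : nat)
    (eqs : seq {mpoly F[n.+1]})
    (f : points j eqs -> points j eqs -> points j eqs) : Prop :=
  forall x1 x2, exists (d e : nat) (P : 'I_n.+1 -> {mpoly F[n.+1 + n.+1]}),
    let ev (y1 y2 : points j eqs) :=
      \row_i mmap j (row_mx (val y1) (val y2) 0) (P i) in
    [/\ forall i, bihomog d e (P i),
        ev x1 x2 != 0 &
        forall y1 y2, ev y1 y2 != 0 ->
          exists c : L, ev y1 y2 = c *: val (f y1 y2)].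

(* A geometrically irreducible projective group variety.  The underlying
   variety is the reduced one; smoothness and commutativity are then automatic,
   and every abelian variety is projective. *)
Record abelian_variety (F : fieldType) (K : closedFieldType)
    (iota : {rmorphism F -> K}) := AbelianVariety {
  av_n : nat;
  av_eqs : seq {mpoly F[av_n.+1]};
  av_add : points iota av_eqs -> points iota av_eqs -> points iota av_eqs;
  av_opp : points iota av_eqs -> points iota av_eqs;
  av_zero : points iota av_eqs;
  av_homog : forall p, p \in av_eqs -> exists d : nat, p \is d.-homog;
  av_irreducible : zirreducible (fun _ : points iota av_eqs => True);
  av_add_regular : regular2 av_add;
  av_opp_regular : regular1 av_opp;
  av_zero_rational : forall i, exists a : F, val av_zero 0 i = iota a;
  av_addA : associative av_add;
  av_add0 : left_id av_zero av_add;
  av_addN : left_inverse av_zero av_opp av_add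
}.

Definition av_points (F : fieldType) (K : closedFieldType)
    (iota : {rmorphism F -> K}) (A : abelian_variety iota) : Type :=
  points iota (av_eqs A).

Definition av_dim (F : fieldType) (K : closedFieldType)
    (iota : {rmorphism F -> K}) (A : abelian_variety iota) (g : nat) : Prop :=
  krull_dim iota (av_eqs A) g.

Definition av_card (F : finFieldType) (K : closedFieldType)
    (iota : {rmorphism F -> K}) (A : abelian_variety iota) : nat :=
  #|[pred v : 'rV[F]_(av_n A).+1 | on_eqs idfun (av_eqs A) v]|.

Definition av_muln (F : fieldType) (K : closedFieldType)
    (iota : {rmorphism F -> K}) (A : abelian_variety iota)
    (m : nat) (x : av_points A) : av_points A :=
  iter m (av_add x) (av_zero A).

Definition av_comb (F : fieldType) (K : closedFieldType)
    (iota : {rmorphism F -> K}) (A : abelian_variety iota)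
    (r : nat) (c : 'I_r -> nat) (x : 'I_r -> av_points A) : av_points A :=
  \big[@av_add F K iota A/av_zero A]_(i < r) av_muln (c i) (x i).

(* [y] is the image of [x] under the [#|F|]-power Frobenius endomorphism. *)
Definition frobenius_image (F : finFieldType) (K : closedFieldType)
    (iota : {rmorphism F -> K}) (A : abelian_variety iota)
    (x y : av_points A) : Prop :=
  val y = map_mx (fun a : K => a ^+ #|F|) (val x).

(* A basis of the [l]-adic Tate module [lim A[l^k]] over the [l]-adic integers:
   [t i] is a compatible sequence of [l^k]-torsion points, and at each level
   the [t i k] form a basis of [A[l^k]] over [Z/l^k]. *)
Definition tate_basis (F : fieldType) (K : closedFieldType)
    (iota : {rmorphism F -> K}) (A : abelian_variety iota)
    (l r : nat) (t : 'I_r -> nat -> av_points A) : Prop :=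
  [/\ forall i, t i 0%N = av_zero A,
      forall i k, av_muln l (t i k.+1) = t i k &
      forall (k : nat) (x : av_points A), av_muln (l ^ k) x = av_zero A ->
        exists! c : {ffun 'I_r -> 'I_(l ^ k)}, 
          x = av_comb (fun i => c i) (fun i => t i k)].

(* [f] is the characteristic polynomial of Frobenius acting on every Tate
   module at a prime [l] other than the characteristic.  [M k] represents the
   matrix of Frobenius modulo [l^k]. *)
Definition weil_polynomial (F : finFieldType) (K : closedFieldType)
    (iota : {rmorphism F -> K}) (A : abelian_variety iota)
    (f : {poly int}) : Prop :=
  forall l : nat, prime l -> l \notin [pchar F] ->
    exists (r : nat) (t : 'I_r -> nat -> av_points A) (M : nat -> 'M[nat]_r),
      [/\ tate_basis l t,
          forall k j, frobenius_image (t j k)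
                        (av_comb (fun i => M k i j) (fun i => t i k)) &
          forall k i, (f`_i = (char_poly (map_mx Posz (M k)))`_i
                         %[mod (l ^ k)%N])%Z].

End AbVar.

From mathcomp Require Import all_classical all_reals all_analysis.
From mathcomp Require Import complex.

Definition specht (R : realType) (h : R) : R :=
  if h == 1 then 1
  else let s := h `^ ((h - 1)^-1) in s / (expR 1 * ln s).

Definition weil_h (R : realType) (q : R) : R :=
  ((Num.sqrt q + 1) / (Num.sqrt q - 1)) ^+ 2.

Definition weil_M (R : realType) (q : R) : R := (specht (weil_h q))^-1.

(* Main.v *)
Require Import Defs.
From HB Require Import structures.
From mathcomp Require Import all_boot all_order all_algebra all_field.
From mathcomp Require Import all_classical all_reals all_analysis.
From mathcomp Require Import complex.
From mathcomp Require Import ring lra.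

(** With [h = weil_h q], the numbers [y_i = q + 1 + x_i = |1 - omega_i|^2] lie
    between [m = (sqrt q - 1)^2] and [m h], and (i) is Specht's reverse AM-GM
    inequality for them.  Put [L = ln h / (h - 1)], so that
    [1 / S(h) = L e^(1-L)].  Concavity of [ln] gives
    [y_i / m >= exp ((y_i / m - 1) L)]; multiply over [i] and apply
    [exp (x - 1) >= x] to [x = L Y / m], where [Y] is the mean of the [y_i].

    For (ii), [x e^(1-x)] increases on the unit interval, so lower bounds for [L] are
    enough.  With [u = 1 / sqrt q],
    [L = (1 - u)^2 / (2 u) * ln ((1 + u) / (1 - u))], and the odd power series
    of the logarithm truncates to a lower bound. *)

Set Implicit Arguments.
Unset Strict Implicit.
Unset Printing Implicit Defensive.

Import Order.TTheory GRing.Theory Num.Theory.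
Import numFieldNormedType.Exports.
Local Open Scope ring_scope.

(** * Elementary estimates for the exponential and the logarithm *)

Lemma expR_ge_taylor5 (R : realType) (x : R) : 0 <= x ->
  1 + x + x ^+ 2 / 2 + x ^+ 3 / 6 + x ^+ 4 / 24 + x ^+ 5 / 120 <= expR x.
Proof.
move=> x0; have -> : 1 + x + x ^+ 2 / 2 + x ^+ 3 / 6 + x ^+ 4 / 24 + x ^+ 5 / 120
    = series (exp_coeff x) 6.
  by rewrite /series /exp_coeff /= unlock /= !factS fact0; field.
rewrite /expR; apply: nondecreasing_cvgn_le.
  by apply: nondecreasing_series => k _ _; exact: exp_coeff_ge0.
exact: is_cvg_series_exp_coeff.
Qed.

Lemma ln_le_subr1 (R : realType) (x : R) : 0 < x -> ln x <= x - 1.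
Proof.
by move=> x0; rewrite -{1}(subrK 1 x) addrC le_ln1Dx //; lra.
Qed.

(** The difference of the two sides vanishes at 0. By a geometric sum its derivative is
    [2 x^(2n) / (1 - x^2) >= 0], so the mean value theorem applies. *)
Lemma ln_ratio_ge_partial_sum (R : realType) (u : R) (n : nat) : 0 <= u < 1 ->
  2 * \sum_(k < n) u ^+ k.*2.+1 / k.*2.+1%:R <= ln ((1 + u) / (1 - u)).
Proof.
move=> /andP[u0 u1].
pose p : {poly R} := \sum_(k < n) (k.*2.+1%:R)^-1 *: 'X^(k.*2.+1).
have pE x : p.[x] = \sum_(k < n) x ^+ k.*2.+1 / k.*2.+1%:R.
  by rewrite horner_sum; apply: eq_bigr => k _; rewrite hornerE hornerXn mulrC.
have dpE x : p^`().[x] = \sum_(k < n) (x ^+ 2) ^+ k.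
  rewrite raddf_sum horner_sum; apply: eq_bigr => k _ /=.
  rewrite derivZ derivXn hornerE hornerMn hornerXn -[_ *+ _]mulr_natr.
  rewrite mul1r -[x ^+ _ *+ _]mulr_natr mulrCA mulVf ?pnatr_eq0 // mulr1.
  by rewrite -exprM mul2n.
pose f x := ln (1 + x) - ln (1 - x) - 2 * p.[x].
pose df x : R := (1 + x)^-1 + (1 - x)^-1 - 2 * p^`().[x].
have fd (x : R) : -1 < x < 1 -> is_derive x (1 : R) f (df x).
  move=> /andP[x0 x1].
  have D1 : is_derive (1 + x) (1 : R) (@ln R) (1 + x)^-1.
    by apply: is_derive1_ln; lra.
  have D2 : is_derive (1 - x) (1 : R) (@ln R) (1 - x)^-1.
    by apply: is_derive1_ln; lra.
  have G1 : is_derive x (1 : R) (cst 1 + id : R -> R) 1.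
    by apply: is_derive_eq; rewrite add0r.
  have G2 : is_derive x (1 : R) (cst 1 - id : R -> R) (- 1).
    by apply: is_derive_eq; rewrite sub0r.
  have E1 := @is_derive1_comp _ (@ln R) _ x _ _ D1 G1.
  have E2 := @is_derive1_comp _ (@ln R) _ x _ _ D2 G2.
  have E := is_deriveB (is_deriveB E1 E2) (is_deriveZ 2 (is_derive_poly p x)).
  by apply: (is_derive_eq E); rewrite /df mulr1 mulrN1 opprK.
have fcont : {within `[0, u], continuous f}%classic.
  apply: derivable_within_continuous => x; rewrite in_itv /= => /andP[x0 x1].
  by apply: ex_derive; apply: fd; lra.
have [|c] := MVT_segment u0 _ fcont (df := df).
  by move=> x; rewrite in_itv /= => /andP[x0 x1]; apply: fd; lra.
rewrite in_itv /= => /andP[c0 cu].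
have f0 : f 0 = 0.
  rewrite /f addr0 subr0 ln1 subrr sub0r pE big1 ?mulr0 ?oppr0 // => k _.
  by rewrite exprS !mul0r.
have df0 : 0 <= df c.
  rewrite /df dpE.
  have c1 : 0 < 1 - c ^+ 2 by nra.
  have -> : (1 + c)^-1 + (1 - c)^-1 = 2 * (1 - c ^+ 2)^-1.
    by field; rewrite !lt0r_neq0 //; lra.
  rewrite -mulrBr mulr_ge0 // subr_ge0 -[leRHS]mul1r ler_pdivlMr //.
  have P0 : 0 <= (c ^+ 2) ^+ n by rewrite !exprn_ge0.
  by have := subrX1 (c ^+ 2) n; lra.
rewrite f0 subr0 subr0 => fu.
have : 0 <= f u by rewrite fu mulr_ge0.
rewrite /f subr_ge0 pE ln_div // posrE; lra.
Qed.

(** * Specht's ratio and the reverse AM-GM inequality *)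

Lemma invr_spechtE (R : realType) (h : R) : 1 < h ->
  (specht h)^-1 = ln h / (h - 1) * expR (1 - ln h / (h - 1)).
Proof.
move=> h1; rewrite /specht gt_eqF // /powR gt_eqF ?(lt_trans _ h1) //.
by rewrite expRK invf_div expRB [(h - 1)^-1 * _]mulrC; ring.
Qed.

(** The tangent of [ln] at [z] lies above the graph at [h] ([T1]) and at 1 ([T2]). Weighting these
    by [z - 1] and [h - z] cancels the slope terms. *)
Lemma ln_chord (R : realType) (h z : R) : 1 < h -> 1 <= z <= h ->
  (z - 1) * (ln h / (h - 1)) <= ln z.
Proof.
move=> h1 /andP[z1 zh].
have z0 : 0 < z by lra.
have T1 : ln h <= ln z + h / z - 1.
  have : ln (h / z) <= h / z - 1 by apply: ln_le_subr1; apply: divr_gt0; lra.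
  by rewrite ln_div ?posrE //; lra.
have T2 : 0 <= ln z + z^-1 - 1.
  have : ln (z^-1) <= z^-1 - 1 by apply: ln_le_subr1; rewrite invr_gt0.
  by rewrite lnV ?posrE //; lra.
rewrite mulrA ler_pdivrMr ?subr_gt0 //.
have := ler_wpM2l (_ : 0 <= z - 1) T1; have := ler_wpM2l (_ : 0 <= h - z) T2.
rewrite !subr_ge0 => /(_ zh) A /(_ z1) B.
have E : (z - 1) * (ln z + h / z - 1) + (h - z) * (ln z + z^-1 - 1)
   = ln z * (h - 1) by field; rewrite lt0r_neq0.
lra.
Qed.

Lemma prodr_ge_specht (R : realType) (g : nat) (m h : R) (y : 'I_g -> R) :
  0 < m -> 1 < h -> (forall i, m <= y i <= m * h) ->
  (specht h)^-1 ^+ g * ((\sum_i y i) / g%:R) ^+ g <= \prod_i y i.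
Proof.
move=> m0 h1 yb; case: g => [|g] in y yb *.
  by rewrite !big_ord0 !expr0 mulr1.
set L := ln h / (h - 1); pose z i := y i / m.
have zb i : 1 <= z i <= h.
  by rewrite ler_pdivlMr // mul1r ler_pdivrMr // [h * m]mulrC yb.
have L0 : 0 < L by rewrite divr_gt0 ?ln_gt0 ?subr_gt0.
have yE i : y i = m * z i by rewrite mulrC divfK ?gt_eqF.
have yl i : m * expR ((z i - 1) * L) <= y i.
  rewrite yE ler_pM2l //; have /andP[z1 _] := zb i.
  have zp : z i \is Num.pos by rewrite posrE; lra.
  by rewrite -[leRHS](lnK zp) ler_expR; exact: ln_chord.
apply: (@le_trans _ _ (\prod_i (m * expR ((z i - 1) * L)))); last first.
  by apply: ler_prod => i _; rewrite yl andbT mulr_ge0 ?expR_ge0 // ltW.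
set Z := (\sum_i y i) / g.+1%:R / m.
have gn : (g.+1%:R : R) != 0 by rewrite pnatr_eq0.
have ZE : (\sum_i y i) / g.+1%:R = m * Z by rewrite /Z [m * _]mulrC divfK ?gt_eqF.
have sE : \sum_i (z i - 1) * L = g.+1%:R * ((Z - 1) * L).
  rewrite -mulr_suml sumrB sumr_const card_ord -mulr_suml /Z.
  by field; rewrite gt_eqF //= addrC natr1.
rewrite big_split /= prodr_const card_ord -expR_sum sE expRM_natl -!exprMn.
have Z0 : 0 <= Z.
  rewrite !divr_ge0 ?(ltW m0) ?sumr_ge0 // => i _.
  by have /andP[+ _] := yb i; apply: le_trans; exact: ltW.
have S0 : 0 <= L * expR (1 - L) by rewrite mulr_ge0 ?expR_ge0 ?ltW.
have mZ0 : 0 <= m * Z by rewrite mulr_ge0 // ltW.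
have mE0 : 0 <= m * expR ((Z - 1) * L) by rewrite mulr_ge0 ?expR_ge0 // ltW.
rewrite invr_spechtE // ZE -/L.
apply: lerXn2r; [by rewrite nnegrE mulr_ge0 | by rewrite nnegrE |].
(* The factor [expR (1 - L)] is the one in [1 / S(h)]; the rest of the exponent is [x - 1] with
   [x = Z * L]. *)
have -> : (Z - 1) * L = (1 - L) + (Z * L - 1) by ring.
rewrite [expR (1 - L + _)]expRD.
have -> : L * expR (1 - L) * (m * Z) = m * (expR (1 - L) * (Z * L)) by ring.
rewrite ler_pM2l // ler_pM2l ?expR_gt0 // (le_trans _ (expR_ge1Dx _)) //.
by rewrite addrC subrK.
Qed.

(** * Lower bounds for [M(q)] *)

Lemma mulr_expR1B_le (R : realType) (l L : R) : 0 <= l -> l <= L -> L <= 1 ->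
  l * expR (1 - l) <= L * expR (1 - L).
Proof.
move=> l0 lL L1.
have -> : 1 - L = 1 - l - (L - l) by ring.
rewrite [expR (1 - l - _)]expRD mulrCA mulrC ler_pM2l ?expR_gt0 //.
(* The middle term exceeds [l] by [(L - l) * (1 - L)]. *)
apply: (@le_trans _ _ (L * (1 - (L - l)))); first by nra.
by rewrite ler_wpM2l ?(le_trans l0) // (le_trans _ (expR_ge1Dx _)).
Qed.

Lemma weil_h_gt1 (R : realType) (q : R) : 1 < q -> 1 < weil_h q.
Proof.
move=> q1; have s1 : 1 < Num.sqrt q by rewrite -sqrtr1 ltr_sqrt //; lra.
rewrite /weil_h exprn_egt1 // ltr_pdivlMr ?subr_gt0 //; lra.
Qed.

Lemma ln_weil_h_div (R : realType) (q : R) : 1 < q -> let s := Num.sqrt q in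
  ln (weil_h q) / (weil_h q - 1) =
  (s - 1) ^+ 2 / (2 * s) * ln ((s + 1) / (s - 1)).
Proof.
move=> q1 s; have s1 : 1 < s by rewrite -sqrtr1 ltr_sqrt //; lra.
rewrite /weil_h -/s lnXn; last by rewrite divr_gt0 //; lra.
rewrite -mulr_natl.
have -> : ((s + 1) / (s - 1)) ^+ 2 - 1 = 4 * s / (s - 1) ^+ 2.
  by field; rewrite gt_eqF // subr_gt0.
by field; rewrite !gt_eqF //; lra.
Qed.

(** Taking [l = 1 - b] turns [e^(1-l)] into [e^b], whose Taylor polynomial makes the bound
    polynomial in [b]. *)
Lemma weil_M_ge (R : realType) (q b : R) : 1 < q -> 0 <= b <= 1 ->
  1 - b <= ln (weil_h q) / (weil_h q - 1) ->
  (1 - b) * (1 + b + b ^+ 2 / 2 + b ^+ 3 / 6 + b ^+ 4 / 24 + b ^+ 5 / 120)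
  <= weil_M q.
Proof.
move=> q1 /andP[b0 b1] lL; have h1 := weil_h_gt1 q1.
have L1 : ln (weil_h q) / (weil_h q - 1) <= 1.
  rewrite ler_pdivrMr ?subr_gt0 // mul1r ln_le_subr1 //; lra.
rewrite /weil_M invr_spechtE //.
have l0 : 0 <= 1 - b by rewrite subr_ge0.
apply: le_trans (mulr_expR1B_le l0 lL L1).
by rewrite ler_wpM2l // subKr expR_ge_taylor5.
Qed.

Lemma truncated_weil_M_ge (R : realFieldType) (u b : R) : 0 < u -> u <= 29 / 50 ->
  b = u * (2 - 4 / 3 * u + 2 / 3 * u ^+ 2) ->
  1 - 2 * u ^+ 2 <=
  (1 - b) * (1 + b + b ^+ 2 / 2 + b ^+ 3 / 6 + b ^+ 4 / 24).
Proof.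
move=> u0 ub bE; rewrite -subr_ge0.
(* [b] is the third order expansion of [1 - L]; both sides agree up to [u ^ 3],
   and their difference has [u ^ 4] coefficient [10 / 9]. *)
set X := (X in 0 <= X).
(* Grouped so that each bracket is nonnegative for [u <= 29 / 50]. The cubic one is reduced to a
   linear one by [u2] and [u3] below. *)
have -> : X = u ^+ 4 * (
    (10 / 9 - 4 / 3 * u + 46 / 81 * u ^+ 2 - 68 / 27 * u ^+ 3)
    + u ^+ 4 * (140 / 27 - 1520 / 243 * u)
    + u ^+ 6 * (3560 / 729 - 1976 / 729 * u)
    + u ^+ 8 * (782 / 729 - 220 / 729 * u)
    + u ^+ 10 * (40 / 729 - 4 / 729 * u)).
  by rewrite /X bE; field.
have ug0 n : 0 <= u ^+ n by rewrite exprn_ge0 // ltW.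
apply: mulr_ge0; first exact: ug0.
do 4! (apply: addr_ge0; last by apply: mulr_ge0; [exact: ug0|lra]).
have u2 : u ^+ 2 <= 29 / 50 * u by rewrite expr2 ler_pM2r.
have u3 : u ^+ 3 <= 29 / 50 * u ^+ 2 by rewrite exprS ler_pM2r ?exprn_gt0.
lra.
Qed.

Lemma weil_M_ge_large (R : realType) (q : R) : 3 <= q -> 1 - 2 / q <= weil_M q.
Proof.
move=> q3; have q1 : 1 < q by lra.
set s := Num.sqrt q; have s1 : 1 < s by rewrite -sqrtr1 ltr_sqrt //; lra.
have s2 : s ^+ 2 = q by rewrite sqr_sqrtr //; lra.
pose u := s^-1.
have us : u * s = 1 by rewrite mulVf // gt_eqF //; lra.
have u0 : 0 < u by rewrite invr_gt0; lra.
(* [29 / 50] is slightly more than [1 / sqrt 3]. *)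
have ub : u <= 29 / 50 by nra.
pose c : R := 2 - 4 / 3 * u + 2 / 3 * u ^+ 2.
have b0 : 0 <= u * c <= 1 by rewrite /c; apply/andP; split; nra.
have lL : 1 - u * c <= ln (weil_h q) / (weil_h q - 1).
  rewrite ln_weil_h_div // -/s.
  have -> : (s + 1) / (s - 1) = (1 + u) / (1 - u).
    by rewrite /u; field; rewrite !gt_eqF //; lra.
  have H : 2 * (u + u ^+ 3 / 3) <= ln ((1 + u) / (1 - u)).
    have := @ln_ratio_ge_partial_sum _ u 2 _.
    rewrite !big_ord_recl big_ord0 /= expr1 divr1 addr0; apply; lra.
  (* The product is [(1 - u)^2 (1 + u^2 / 3)]; dropping its [u^4 / 3] keeps [u * c] cubic. *)
  have E : (s - 1) ^+ 2 / (2 * s) * (2 * (u + u ^+ 3 / 3)) = 1 - u * c + u ^+ 4 / 3.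
    rewrite /c /u; field; rewrite gt_eqF //; lra.
  apply: le_trans (ler_wpM2l _ H); last by rewrite divr_ge0 ?sqr_ge0 //; lra.
  rewrite E lerDl; apply: divr_ge0 => //; apply: exprn_ge0; lra.
apply: le_trans (weil_M_ge q1 b0 lL).
have -> : 2 / q = 2 * u ^+ 2 by rewrite -s2 -exprVn.
(* Degree four of the Taylor polynomial suffices here; the fifth is for [q = 2]. *)
apply: le_trans (truncated_weil_M_ge u0 ub (erefl _)) _; rewrite -/c.
have /andP[bge0 ble1] := b0.
by rewrite ler_wpM2l ?subr_ge0 // lerDl divr_ge0 ?exprn_ge0.
Qed.

Lemma weil_M_ge_2 (R : realType) : 261 / 1000 <= weil_M (2 : R).
Proof.
have q1 : 1 < 2 :> R by lra.
set s : R := Num.sqrt 2.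
have s2 : s ^+ 2 = 2 by rewrite sqr_sqrtr.
have s0 : 0 <= s by rewrite sqrtr_ge0.
(* A continued fraction convergent: [1393 ^ 2 = 2 * 985 ^ 2 - 1]. *)
have sl : 1393 / 985 <= s by nra.
have su : s <= 3 / 2 by nra.
have ln_ge : 17624 / 10000 <= ln ((s + 1) / (s - 1)).
  (* Since [s ^ 2 = 2], the argument is the square of [s + 1], which is the ratio
     for [v = s - 1]; this makes the series converge much faster. *)
  pose v := s - 1.
  (* Modulo [s^2 = 2] odd powers of [v] are linear in [s], so the bound from four terms is linear
     too. *)
  have v3 : v ^+ 3 = 5 * s - 7 by rewrite /v; ring: s2.
  have v5 : v ^+ 5 = 29 * s - 41 by rewrite /v; ring: s2.
  have v7 : v ^+ 7 = 169 * s - 239 by rewrite /v; ring: s2.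
  have -> : (s + 1) / (s - 1) = ((1 + v) / (1 - v)) ^+ 2.
    have -> : (1 + v) / (1 - v) = s + 1.
      apply: (canLR (mulfK _)); first by rewrite gt_eqF /v //; lra.
      by rewrite /v; ring: s2.
    by apply: (canLR (mulfK _)); [rewrite gt_eqF //; lra | ring: s2].
  rewrite lnXn; last by rewrite divr_gt0 /v //; lra.
  have : 0 <= v < 1 by rewrite /v; lra.
  move=> /(ln_ratio_ge_partial_sum 4).
  rewrite !big_ord_recl big_ord0 /= /bump /= expr1 divr1 addr0 v3 v5 v7 /v.
  rewrite !(addn0, add1n, doubleS, double0) -[ln _ *+ 2]mulr_natr.
  lra.
(* An opaque [b] keeps unification from unfolding the numeral. *)
have [b bE] : exists b : R, b = 8931 / 10000 by eexists.
have b01 : 0 <= b <= 1 by clear -bE; apply/andP; split; lra.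
(* Here [L = 0.10692...], just above [1 - b = 0.1069]. *)
have lL : 1 - b <= ln (weil_h 2) / (weil_h 2 - 1).
  rewrite ln_weil_h_div // -/s.
  have -> : (s - 1) ^+ 2 / (2 * s) = 3 / 4 * s - 1.
    by clear -s2 s0 sl; apply: (canLR (mulfK _)); [rewrite gt_eqF //; lra | field: s2].
  have c0 : 0 <= 3 / 4 * s - 1 by clear -sl; lra.
  apply: le_trans (ler_wpM2l c0 ln_ge); clear -sl bE; lra.
apply: le_trans (weil_M_ge q1 b01 lL); clear -bE; rewrite bE; lra.
Qed.

Theorem theorem2p7 (R : realType)
    (F : finFieldType) (K : closedFieldType) (iota : {rmorphism F -> K})
    (HK : integralRange iota)
    (A : AbVar.abelian_variety iota) (g : nat) (Hg : AbVar.av_dim A g)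
    (f : {poly int}) (Hf : AbVar.weil_polynomial A f)
    (omega : 'I_g -> complex R)
    (Hroots : map_poly intr f =
       \prod_(i < g) (('X - (omega i)%:P) * ('X - ((omega i)^*)%:P)))
    (Hweil : forall i, `|omega i| = sqrtC #|F|%:R)
    (Hcard : (AbVar.av_card A)%:Z = f.[1])
    (tau : int) (Htau : tau%:~R = \sum_(i < g) - (omega i + (omega i)^*)) :
  let q : R := #|F|%:R in
  ((AbVar.av_card A)%:R >= weil_M q ^+ g * (q + 1 + tau%:~R / g%:R) ^+ g)
  /\
  ((AbVar.av_card A)%:R >=
     (if #|F| == 2%N then 261 / 1000 else 1 - 2 / q) ^+ g
       * (q + 1 + tau%:~R / g%:R) ^+ g).
Proof.
move=> q.
have q2 : 2 <= q by rewrite ler_nat finNzRing_gt1.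
set s := Num.sqrt q; have s1 : 1 < s by rewrite -sqrtr1 ltr_sqrt //; lra.
have s2 : s ^+ 2 = q by rewrite sqr_sqrtr //; lra.
pose re i := complex.Re (omega i).
have reE i : omega i + (omega i)^* = (2 * re i)%:C%C.
  rewrite /re; case: (omega i) => a b; apply/eqP; rewrite eq_complex /=.
  by rewrite subrr eqxx andbT mulr2n mulrDl mul1r.
have normE i : omega i * (omega i)^* = q%:C%C.
  by rewrite -normCK Hweil sqrtCK /q rmorph_nat.
have reb i : - s <= re i <= s.
  have := normE i; rewrite /re; case: (omega i) => a b /eqP.
  rewrite eq_complex /= => /andP[/eqP E _].
  rewrite -ler_norml -ler_sqr ?nnegrE ?normr_ge0 //; last lra.
  rewrite real_normK ?num_real //; nra.
pose y i := q + 1 - 2 * re i.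
(* The factorization of [f] lives over the complex numbers; injectivity of the embedding brings the
   identity back to [R]. *)
have cardE : (AbVar.av_card A)%:R = \prod_i y i.
  apply: (@complexI R); rewrite rmorph_nat rmorph_prod /=.
  have -> : (AbVar.av_card A)%:R = (map_poly intr f).[1] :> complex R.
    by rewrite -(rmorph1 intr) horner_map -Hcard.
  rewrite Hroots horner_prod; apply: eq_bigr => i _.
  rewrite !hornerE.
  have -> : (1 - omega i) * (1 - (omega i)^*) =
    1 - (omega i + (omega i)^*) + omega i * (omega i)^* by ring.
  by rewrite reE normE /y rmorphB rmorphD rmorph1 addrAC [1 + _]addrC.
have tauE : tau%:~R = \sum_i - (2 * re i) :> R.
  apply: (@complexI R); rewrite rmorph_int Htau rmorph_sum /=.
  by apply: eq_bigr => i _; rewrite reE rmorphN.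
have m0 : 0 < (s - 1) ^+ 2 by rewrite exprn_gt0 // subr_gt0.
have h1 : 1 < weil_h q by apply: weil_h_gt1; lra.
(* Since [(s - 1)^2 h = (s + 1)^2], the bounds are the values of [q + 1 - 2 re i] at [re i = s] and
   [re i = - s]. *)
have yb i : (s - 1) ^+ 2 <= y i <= (s - 1) ^+ 2 * weil_h q.
  rewrite /weil_h -/s -exprMn mulrC divfK; last by rewrite gt_eqF // subr_gt0.
  by rewrite /y -s2; have /andP[r1 r2] := reb i; apply/andP; split; nra.
have := prodr_ge_specht m0 h1 yb; rewrite -cardE.
(* In dimension 0 the quotient by [g] is not a mean, but all powers are 1. *)
have [g0|g0] := posnP g.
  by subst g; rewrite !expr0 mulr1.
have gn : (g%:R : R) != 0 by rewrite pnatr_eq0 -lt0n.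
have -> : q + 1 + tau%:~R / g%:R = (\sum_i y i) / g%:R.
  rewrite big_split /= sumr_const card_ord -[(q + 1) *+ g]mulr_natr -tauE.
  by rewrite mulrDl mulfK.
rewrite -/(weil_M q) => main; split=> //.
apply: le_trans main.
rewrite ler_wpM2r ?exprn_ge0 //.
  rewrite divr_ge0 ?sumr_ge0 // => i _.
  by have /andP[+ _] := yb i; apply: le_trans; exact: ltW.
(* Nonnegativity of [C] is needed to raise [C <= M(q)] to the power [g]. *)
set C := (C in C ^+ g); have /andP[C0 CM] : 0 <= C <= weil_M q.
  rewrite /C; have [F2|F2] := eqVneq #|F| 2%N.
    have -> : q = 2 by rewrite /q F2.
    by apply/andP; split; [clear; lra | exact: weil_M_ge_2].
  have q3 : 3 <= q by rewrite ler_nat ltn_neqAle eq_sym F2 finNzRing_gt1.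
  apply/andP; split; last exact: weil_M_ge_large.
  by rewrite subr_ge0 ler_pdivrMr ?mul1r //; lra.
by apply: lerXn2r; rewrite ?nnegrE // (le_trans C0).
Qed.
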